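(* Let $\varkappa\in(1,\varkappa_{\max}]$ and let $\mathscr{A}=\{A,B\}$ with $$A=\begin{pmatrix}0&-\frac1\varkappa\\ \varkappa&-1\end{pmatrix},\qquad B=\begin{pmatrix}0&-\varkappa\\ \frac1\varkappa&-1\end{pmatrix}.$$ Then the generalized spectral radius of $\mathscr{A}$ is $$\bar\rho(\mathscr{A})=\lambda^{1/3},\qquad\text{where }\lambda=\rho(BAA)=\rho(BBA)=\varkappa^2,$$ and the products $BAA$ and $BBA$ are spectrum maximizing for $\mathscr{A}$.
   Context: The number $\varkappa_{\max}$ ($\approx 1.447892$) is the unique solution $\varkappa>1$ of the equation $\varkappa^{2/3}=\dfrac{(\varkappa^2+1)^2}{\varkappa^4+\varkappa^2+1}$. For a finite set $\mathscr{A}$ of real $d\times d$ matrices, let $\bar\rho_n(\mathscr{A})=\max \rho(X_n\cdots X_1)^{1/n}$, the maximum being over all $X_1,\ldots,X_n\in\mathscr{A}$, where $\rho(\cdot)$ of a matrix is its spectral radius. The generalized spectral radius is $\bar\rho(\mathscr{A})=\limsup_{n\to\infty}\bar\rho_n(\mathscr{A})$. A product $X_n\cdots X_1$ of $n$ factors from $\mathscr{A}$ is called spectrum maximizing for $\mathscr{A}$ if $\bar\rho(\mathscr{A})=\rho(X_n\cdots X_1)^{1/n}$. *)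

(* Defs.v *)
From mathcomp Require Import all_boot all_order all_algebra finmap.
From mathcomp Require Import all_classical all_reals all_analysis.
From mathcomp Require Import complex ring lra.

Set Implicit Arguments.
Unset Strict Implicit.
Unset Printing Implicit Defensive.

Import Order.TTheory GRing.Theory Num.Theory.

Local Open Scope classical_set_scope.
Local Open Scope ring_scope.

(* Maximal modulus of the complex eigenvalues of a real matrix.  For d > 0 the
   set of moduli is finite and nonempty, so the supremum is attained. *)
Definition spectral_radius (R : realType) (d : nat) (M : 'M[R]_d) : R :=
  sup [set complex.Re `|z| | z in
        [set z : R[i] | eigenvalue (map_mx (real_complex R) M) z]].

(* A product X_n ... X_1 is represented by the word [:: X_n; ...; X_1], listed
   in the order in which it is written. *)
Definition word_prod (R : realType) (d : nat) (w : seq 'M[R]_d) : 'M[R]_d :=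
  \prod_(X <- w) X.

(* The exponent is 1/n, so only n > 0 is meaningful.  The default value 0 of
   the maximum is harmless, since all the terms are nonnegative. *)
Definition rho_bar_n (R : realType) (d : nat) (S : {fset 'M[R]_d}) (n : nat)
    : R :=
  \big[Num.max/0]_(w : n.-tuple S)
     spectral_radius (word_prod [seq val X | X <- w]) `^ n%:R^-1.

Definition generalized_spectral_radius (R : realType) (d : nat)
    (S : {fset 'M[R]_d}) : \bar R :=
  limn_esup (fun n => (rho_bar_n S n)%:E).

Definition spectrum_maximizing (R : realType) (d : nat) (S : {fset 'M[R]_d})
    (w : seq 'M[R]_d) : Prop :=
  [/\ (0 < size w)%N, {subset w <= S} &
      generalized_spectral_radius S =
        (spectral_radius (word_prod w) `^ (size w)%:R^-1)%:E].

Definition mx22 (R : realType) (a b c d : R) : 'M[R]_2 :=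
  \matrix_(i < 2, j < 2)
    (if i == 0 then (if j == 0 then a else b) else (if j == 0 then c else d)).

Definition matA (R : realType) (k : R) : 'M[R]_2 := mx22 0 (- k^-1) k (- 1).

Definition matB (R : realType) (k : R) : 'M[R]_2 := mx22 0 (- k) k^-1 (- 1).

Definition kappa_max_eq (R : realType) (k : R) : Prop :=
  1 < k /\ k `^ (2 / 3) = (k ^+ 2 + 1) ^+ 2 / (k ^+ 4 + k ^+ 2 + 1).

Definition kappa_max (R : realType) : R :=
  xget 0 [set k | kappa_max_eq k].

(* The equation in the variable t = k `^ (2 / 3), for which t ^+ 3 = k ^+ 2. *)
Definition kpoly (R : realType) (t : R) : R :=
  t ^+ 7 - t ^+ 6 + t ^+ 4 - 2 * t ^+ 3 + t - 1.

Lemma kappa_max_eqE (R : realType) (k : R) : 1 < k ->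
  kappa_max_eq k <-> kpoly (k `^ (2 / 3)) = 0.
Proof.
move=> k1; have k0 : 0 <= k by lra.
have t3 : (k `^ (2 / 3)) ^+ 3 = k ^+ 2.
  by rewrite -powR_mulrn ?powR_ge0// -powRrM divfK ?pnatr_eq0// powR_mulrn.
rewrite /kappa_max_eq /kpoly; move: t3; set t := k `^ _ => t3.
have -> : k ^+ 4 = t ^+ 6 by rewrite (exprM k 2 2) (exprM t 3 2) t3.
rewrite -t3.
have t0 : 0 < t by rewrite powR_gt0//; lra.
have den0 : t ^+ 6 + t ^+ 3 + 1 != 0.
  by rewrite gt_eqF// ltr_wpDl// addr_ge0// exprn_ge0// ltW.
split=> [[_ E]|E].
  have := divfK den0 ((t ^+ 3 + 1) ^+ 2); rewrite -E => F.
  move/eqP: F; rewrite -subr_eq0 => /eqP F; rewrite -F; ring.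
split=> //; apply: (mulIf den0); rewrite divfK//.
apply/eqP; rewrite -subr_eq0; apply/eqP; rewrite -E; ring.
Qed.

Lemma kpoly_inc (R : realType) (s t : R) : 1 <= s -> s < t -> kpoly s < kpoly t.
Proof.
move=> s1 st.
have E (u : R) : kpoly u = (u - 1) ^+ 7 + 6 * (u - 1) ^+ 6
    + 15 * (u - 1) ^+ 5 + 21 * (u - 1) ^+ 4 + 17 * (u - 1) ^+ 3
    + 6 * (u - 1) ^+ 2 - 1.
  by rewrite /kpoly; ring.
have H n : (0 < n)%N -> (s - 1) ^+ n < (t - 1) ^+ n.
  by move=> n0; rewrite ltrXn2r// -?lt0n//; lra.
rewrite !E.
have := H 7 isT; have := H 6 isT; have := H 5 isT; have := H 4 isT.
have := H 3 isT; have := H 2 isT; lra.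
Qed.

Lemma kappa_max_exists (R : realType) : exists! k : R, kappa_max_eq k.
Proof.
have [t /andP[t1 t2] rt] : exists2 t : R, 1 <= t <= 2 & kpoly t = 0.
  pose p : {poly R} := 'X^7 - 'X^6 + 'X^4 - 2%:P * 'X^3 + 'X - 1.
  have pE u : p.[u] = kpoly u by rewrite /p /kpoly !hornerE.
  have le12 : (1 : R) <= 2 by lra.
  have [|t tb /eqP rt] := @poly_ivt R p 1 2 le12.
    by rewrite !pE /kpoly; lra.
  by exists t; rewrite -?pE.
have {}t1 : 1 < t.
  rewrite lt_neqAle t1 andbT; apply/eqP => t1'.
  by move: rt; rewrite -t1' /kpoly; lra.
have tk : (t `^ (3 / 2)) `^ (2 / 3) = t.
  rewrite -powRrM (_ : 3 / 2 * (2 / 3) = 1); last by field.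
  by rewrite powRr1//; lra.
have powR_gt1 (x a : R) : 1 < x -> 0 < a -> 1 < x `^ a.
  move=> x1 a0; rewrite -[ltLHS](congr1 (@^~ a) (powR1 R)) gt0_ltr_powR// nnegrE; lra.
exists (t `^ (3 / 2)); split.
  apply/kappa_max_eqE; last by rewrite tk.
  by apply: powR_gt1 => //; lra.
move=> k ek; have [k1 _] := ek; move/(kappa_max_eqE k1): ek.
set u := k `^ _ => ru; have u1 : 1 < u by apply: powR_gt1 => //; lra.
have -> : t = u.
  case: (ltgtP t u) => // [/(kpoly_inc (ltW t1))|/(kpoly_inc (ltW u1))].
    by rewrite rt ru ltxx.
  by rewrite rt ru ltxx.
rewrite /u -powRrM (_ : 2 / 3 * (3 / 2) = 1); last by field.
by rewrite powRr1//; lra.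
Qed.

Lemma kappa_maxP (R : realType) : kappa_max_eq (kappa_max R).
Proof.
by apply: xgetPex; have [k [ek _]] := kappa_max_exists R; exists k.
Qed.

(* Main.v *)
Require Import Defs.
From mathcomp Require Import all_boot all_order all_algebra finmap.
From mathcomp Require Import all_classical all_reals all_analysis.
From mathcomp Require Import complex ring lra.
Import Order.TTheory GRing.Theory Num.Theory.
Local Open Scope ring_scope.

Set Implicit Arguments.
Unset Strict Implicit.
Unset Printing Implicit Defensive.

(** Put t = k^(2/3), so that t^3 = k^2.  Both B A A and B B A have trace
k^2 + k^-2 and determinant 1, hence leading eigenvalue k^2 = t^3; the powers of
B A A show that the generalized spectral radius is at least t
([spectral_radius_det1], [generalized_spectral_radius_max]).

For the upper bound, a centrally symmetric polygon P is exhibited with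
A P and B P contained in t P.  Every word w then satisfies w P in t^|w| P, which
forces every eigenvalue of w to have modulus at most t^|w|
([eigenvalue_word_le]).  The vertices of P are, up to sign, two orbits of
leading eigenvectors:
    A v0 = t v1,  A v1 = t v2,  B v2 = t v0,     so B A A v0 = t^3 v0;
    B w0 = t w1,  B w1 = t w2,  A w2 = t w0,     so A B B w0 = t^3 w0.
In the hyperbolic plane A and B are rotations of order 3 about two different
points, and the half-turn about the midpoint exchanges them; the two orbits are
scaled so that this half-turn maps v_i to w_i.  This produces the length
s = sqrt (k^4 + k^2 + 1) in w0 = (0, s) when v0 = (k^2 + 1, k).

Six of the twelve images of vertices are thus t times vertices.  Two more,
A v2 = A^3 v0 / t^2 and B w2, are t^-2 times vertices because A^3 = B^3 = 1.
Each of the last four lies on a combination of two vertices with coefficients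
a, b, and by the symmetry there are only two inequalities |a| + |b| <= t to
check.  One amounts to s^2 <= t (k^2 + 1)^2, which always holds; the other is
    t (k^4 + k^2 + 1) <= (k^2 + 1)^2,
and this is precisely the condition k <= kappa_max ([edge_bounds],
[kappa_threshold]). *)

(** * Invariant polygons bound eigenvalues *)

Definition cplx {R : realType} {m n} (M : 'M[R]_(m, n)) : 'M[R[i]]_(m, n) :=
  map_mx (real_complex R) M.

(** Row vectors are complex because eigenvalues of a real matrix may be
complex; the points of the polygon stay real. *)
Definition pairing {R : realType} {d} (v : 'rV[R[i]]_d) (x : 'cV[R]_d) : R[i] :=
  (v *m cplx x) 0 0.

Lemma normc_ge0 (R : realType) (z : R[i]) : 0 <= Normc.normc z.
Proof. by case: z => a b; exact: sqrtr_ge0. Qed.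

Lemma normc_real (R : realType) (a : R) : Normc.normc a%:C%C = `|a|.
Proof. by rewrite /= expr0n addr0 sqrtr_sqr. Qed.

Lemma normcX (R : realType) (z : R[i]) n :
  Normc.normc (z ^+ n) = Normc.normc z ^+ n.
Proof.
elim: n => [|n IH]; first exact: Normc.normc1.
by rewrite !exprS Normc.normcM IH.
Qed.

(** A sufficient condition for x to lie in t times the absolutely convex hull
of V.  Two points suffice in the plane, where the hull is a polygon and every
boundary point lies on an edge. *)
Definition in_hull {R : realType} {d} (t : R) (V : seq 'cV[R]_d)
    (x : 'cV[R]_d) : Prop :=
  exists y z a b, [/\ y \in V, z \in V, x = a *: y + b *: z & `|a| + `|b| <= t].

Lemma pairing_le_hull (R : realType) d (V : seq 'cV[R]_d) (t b : R) x v :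
  in_hull t V x -> (forall y, y \in V -> Normc.normc (pairing v y) <= b) ->
  Normc.normc (pairing v x) <= t * b.
Proof.
move=> [y [z [a [c [yV zV -> act]]]]] vb.
have -> : pairing v (a *: y + c *: z) =
    a%:C%C * pairing v y + c%:C%C * pairing v z.
  by rewrite /pairing /cplx map_mxD !map_mxZ mulmxDr -!scalemxAr !mxE.
apply: (le_trans (le_normcD _ _)); rewrite !Normc.normcM !normc_real.
have b0 : 0 <= b by apply: le_trans (vb _ yV); exact: normc_ge0.
apply: le_trans (ler_wpM2r b0 act); rewrite mulrDl.
by apply: lerD; apply: ler_wpM2l => //; exact: vb.
Qed.

(** In the dual picture, v |-> max |v x| over x in V is a seminorm on row
vectors that right multiplication by a matrix of S expands at most by the
factor t. *)
Lemma pairing_le_word (R : realType) d (S : {fset 'M[R]_d}) (V : seq 'cV[R]_d)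
    (t : R) :
  (forall X x, X \in S -> x \in V -> in_hull t V (X *m x)) ->
  forall (w : seq 'M[R]_d) (v : 'rV[R[i]]_d) (b : R), {subset w <= S} ->
  (forall x, x \in V -> Normc.normc (pairing v x) <= b) ->
  forall x, x \in V ->
    Normc.normc (pairing (v *m cplx (word_prod w)) x) <= t ^+ size w * b.
Proof.
move=> SV; elim=> [|X w IH] v b wS vb x xV.
  by rewrite /word_prod big_nil /cplx map_mx1 mulmx1 mul1r vb.
rewrite /word_prod big_cons -/(word_prod w) /= exprSr -mulrA.
have -> : cplx (X * word_prod w) = cplx X *m cplx (word_prod w).
  by rewrite /cplx -map_mxM.
rewrite mulmxA; apply: IH => // [Y Yw|y yV].
  by apply: wS; rewrite inE Yw orbT.
have -> : pairing (v *m cplx X) y = pairing v (X *m y).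
  by rewrite /pairing /cplx map_mxM mulmxA.
by apply: pairing_le_hull vb; apply: SV => //; apply: wS; rewrite mem_head.
Qed.

(** Applied to a complex left eigenvector v of the word, the dual norm (a norm
since V spans) gives |z| * |v| <= t^n * |v|.  Real and complex eigenvalues are
treated alike, because the real coefficients of the hull act on complex
values. *)
Lemma eigenvalue_word_le (R : realType) d (S : {fset 'M[R]_d})
    (V : seq 'cV[R]_d) (t : R) :
  (forall X x, X \in S -> x \in V -> in_hull t V (X *m x)) ->
  (forall v, (forall x, x \in V -> pairing v x = 0) -> v = 0) ->
  forall (w : seq 'M[R]_d) z, {subset w <= S} ->
  eigenvalue (cplx (word_prod w)) z -> Normc.normc z <= t ^+ size w.
Proof.
move=> SV V_sep w z wS /eigenvalueP[v vz v0].
pose b := \big[Num.max/0]_(x <- V) Normc.normc (pairing v x).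
have vb x : x \in V -> Normc.normc (pairing v x) <= b.
  move=> xV.
  exact: (@le_bigmax_seq _ _ _ _ 0 x predT
    (fun y => Normc.normc (pairing v y))).
have zv x : pairing (z *: v) x = z * pairing v x.
  by rewrite /pairing -scalemxAl mxE.
have b_gt0 : 0 < b.
  rewrite lt_neqAle bigmax_ge_id andbT; apply/eqP => b0.
  case/eqP: v0; apply: V_sep => x xV; apply: Normc.eq0_normc.
  by apply/le_anti; rewrite normc_ge0 andbT b0 vb.
have tb : 0 <= t ^+ size w * b.
  have [x xV _] : exists2 x, x \in V & true.
    move: b_gt0; rewrite /b; case: (V) => [|x s].
      by rewrite big_nil ltxx.
    by exists x; rewrite ?mem_head.
  by apply: le_trans (pairing_le_word SV wS vb xV); exact: normc_ge0.
have : Normc.normc z * b <= t ^+ size w * b; last by rewrite ler_pM2r.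
have [->|z0] := eqVneq (Normc.normc z) 0; first by rewrite mul0r.
have z_gt0 : 0 < Normc.normc z by rewrite lt_def z0 normc_ge0.
rewrite -ler_pdivlMl // {1}/b big_seq; apply: bigmax_le => [|x xV].
  by rewrite mulr_ge0 // invr_ge0 normc_ge0.
rewrite ler_pdivlMl // -Normc.normcM -zv -vz.
by apply: (pairing_le_word SV wS vb xV).
Qed.

(** * Spectral radii *)

Lemma ubound_eigenvalues (R : realType) d (M : 'M[R]_d) (b : R) :
  (forall z, eigenvalue (cplx M) z -> Normc.normc z <= b) ->
  ubound (T:=R) [set complex.Re `|z| | z in
    [set z | eigenvalue (cplx M) z]]%classic b.
Proof. by move=> Mb _ [z Mz <-]; exact: Mb. Qed.

Lemma spectral_radius_le (R : realType) d (M : 'M[R]_d) (b : R) :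
  0 <= b -> (forall z, eigenvalue (cplx M) z -> Normc.normc z <= b) ->
  spectral_radius M <= b.
Proof.
move=> b0 /ubound_eigenvalues Mb; rewrite /spectral_radius.
have [->|/set0P E0] := eqVneq [set complex.Re `|z| | z in
    [set z | eigenvalue (cplx M) z]]%classic set0; first by rewrite sup0.
exact: ge_sup.
Qed.

Lemma le_spectral_radius (R : realType) d (M : 'M[R]_d) (b : R) z :
  (forall z, eigenvalue (cplx M) z -> Normc.normc z <= b) ->
  eigenvalue (cplx M) z -> Normc.normc z <= spectral_radius M.
Proof.
move=> /ubound_eigenvalues Mb Mz; apply: ub_le_sup; first by exists b.
by exists z.
Qed.

Lemma spectral_radius_ge0 (R : realType) d (M : 'M[R]_d) :
  0 <= spectral_radius M.
Proof.
rewrite /spectral_radius; set E := (X in sup X).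
have [[[x Ex] Eub]|/sup_out ->//] := pselect (has_sup E).
apply: le_trans (ub_le_sup Eub Ex).
by case: Ex => z _ <-; exact: normc_ge0.
Qed.

Lemma eigenvalue_mx2 (F : fieldType) (M : 'M[F]_2) z :
  eigenvalue M z = (z ^+ 2 - \tr M * z + \det M == 0).
Proof.
have cp2 : (char_poly M)`_2 = 1.
  have := char_poly_monic M; rewrite monicE lead_coefE size_char_poly => /eqP.
  by [].
have cp1 : (char_poly M)`_1 = - \tr M by exact: (@char_poly_trace _ 2 M).
rewrite eigenvalue_root_char rootE horner_coef size_char_poly.
rewrite !big_ord_recl big_ord0 /= /bump /= cp2 cp1 char_poly_det.
by congr (_ == 0); ring.
Qed.

(** The eigenvalues are a and 1 / a, the roots of z^2 - (a + 1/a) z + 1. *)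
Lemma spectral_radius_det1 (R : realType) (M : 'M[R]_2) (a : R) :
  1 <= a -> \tr M = a + a^-1 -> \det M = 1 ->
  eigenvalue (cplx M) a%:C%C /\ spectral_radius M = a.
Proof.
move=> a1 trM detM; have a0 : a != 0 by lra.
have eigM z : eigenvalue (cplx M) z = (z == a%:C%C) || (z == (a^-1)%:C%C).
  rewrite eigenvalue_mx2 trace_map_mx det_map_mx trM detM rmorph1 rmorphD /=.
  rewrite -[z == a%:C%C]subr_eq0 -[z == _]subr_eq0 -mulf_eq0.
  have aV : a%:C%C * (a^-1)%:C%C = 1 :> R[i] by rewrite -rmorphM /= divff.
  congr (_ == 0).
  transitivity (z ^+ 2 - (a%:C%C + (a^-1)%:C%C) * z + a%:C%C * (a^-1)%:C%C).
    by rewrite aV.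
  by ring.
have ea : eigenvalue (cplx M) a%:C%C by rewrite eigM eqxx.
have le_a z : eigenvalue (cplx M) z -> Normc.normc z <= a.
  rewrite eigM => /orP[] /eqP ->; rewrite normc_real ger0_norm; try lra.
    by apply: (@le_trans _ _ 1) => //; rewrite invf_le1 //; lra.
  by rewrite invr_ge0; lra.
split=> //; apply/le_anti/andP; split.
  by apply: spectral_radius_le => //; lra.
apply: le_trans (le_spectral_radius le_a ea).
by rewrite normc_real ler_norm.
Qed.

Lemma eigenvalueX (F : fieldType) d (M : 'M[F]_d) z m :
  eigenvalue M z -> eigenvalue (M ^+ m) (z ^+ m).
Proof.
move=> /eigenvalueP[v vM v0]; apply/eigenvalueP; exists v => //.
elim: m => [|m IH]; first by rewrite !expr0 mulmx1 scale1r.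
by rewrite exprSr mulmxA IH -scalemxAl vM scalerA -exprSr.
Qed.

Lemma limn_esup_attained (R : realType) (u : nat -> R) (l : R) :
  (forall n, u n <= l) -> (forall N, exists2 n, (N <= n)%N & l <= u n) ->
  limn_esup (fun n => (u n)%:E) = l%:E.
Proof.
move=> ul lu; rewrite /limn_esup limf_esupE; apply/le_anti/andP; split.
  apply: ge_ereal_inf.
  exists (ereal_sup ((fun n => (u n)%:E) @` setT)%classic).
    by exists setT => //; exact: filterT.
  by apply: ge_ereal_sup => _ [n _ <-]; rewrite lee_fin.
apply: le_ereal_inf_tmp => _ [V [N _ NV] <-].
have [n Nn ln] := lu N.
apply: (@le_trans _ _ (u n)%:E); first by rewrite lee_fin.
by apply: ereal_sup_ubound; exists n => //; exact: NV.
Qed.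

(** The case n = 0 is covered too: the exponent is then 0^-1 = 0, and any base
has 0-th power 1. *)
Lemma rho_bar_n_le (R : realType) d (S : {fset 'M[R]_d}) (t : R) n :
  1 <= t ->
  (forall w, {subset w <= S} -> spectral_radius (word_prod w) <= t ^+ size w) ->
  rho_bar_n S n <= t.
Proof.
move=> t1 rw; have t0 : 0 <= t by lra.
apply: bigmax_le => // w _.
have wS : {subset [seq val X | X <- w] <= S}.
  by move=> _ /mapP[X _ ->]; exact: valP.
have := rw _ wS; rewrite size_map size_tuple => le_tn.
apply: (@le_trans _ _ ((t ^+ n) `^ n%:R^-1)).
  by apply: ge0_ler_powR; rewrite ?nnegrE ?invr_ge0 ?ler0n ?exprn_ge0
    ?spectral_radius_ge0.
rewrite -powR_mulrn // -powRrM.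
case: n {w wS le_tn} => [|n]; first by rewrite mul0r powRr0.
by rewrite mulfV ?pnatr_eq0 // powRr1.
Qed.

Lemma le_rho_bar_n (R : realType) d (S : {fset 'M[R]_d}) w :
  {subset w <= S} ->
  spectral_radius (word_prod w) `^ (size w)%:R^-1 <= rho_bar_n S (size w).
Proof.
move=> wS; have [s ->] : exists s : seq S, w = [seq val X | X <- s].
  elim: w wS => [|X w IH] XwS; first by exists [::].
  have [|s ->] := IH; first by move=> Y Yw; apply: XwS; rewrite inE Yw orbT.
  by exists ([` XwS _ (mem_head X w)]%fset :: s).
rewrite size_map.
exact: (@le_bigmax _ _ _ 0 (fun w : (size s).-tuple S => spectral_radius
  (word_prod [seq val X | X <- w]) `^ (size s)%:R^-1) (in_tuple s)).
Qed.

(** The powers u^m give terms of index m * |u| that reach the upper bound t. *)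
Lemma generalized_spectral_radius_max (R : realType) d (S : {fset 'M[R]_d.+1})
    (t : R) (u : seq 'M[R]_d.+1) :
  1 <= t ->
  (forall w z, {subset w <= S} -> eigenvalue (cplx (word_prod w)) z ->
     Normc.normc z <= t ^+ size w) ->
  (0 < size u)%N -> {subset u <= S} ->
  eigenvalue (cplx (word_prod u)) (t ^+ size u)%:C%C ->
  generalized_spectral_radius S = t%:E.
Proof.
move=> t1 eig_le u_gt0 uS eig_u; have t0 : 0 <= t by lra.
apply: limn_esup_attained => [n|N].
  apply: rho_bar_n_le => // w wS.
  by apply: spectral_radius_le => [|z]; [exact: exprn_ge0 | exact: eig_le].
pose w := flatten (nseq N.+1 u).
have wS : {subset w <= S} by move=> X /flattenP[v /nseqP[-> _]] /uS.
have w_size : size w = (N.+1 * size u)%N.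
  by rewrite /w size_flatten /shape map_nseq sumn_nseq mulnC.
have wE : word_prod w = word_prod u ^+ N.+1.
  by rewrite /word_prod big_flatten big_nseq iter_mulr_1.
exists (size w).
  by rewrite w_size (leq_trans (leqnSn N)) ?leq_pmulr.
apply: le_trans (le_rho_bar_n wS).
have eig_w : eigenvalue (cplx (word_prod w)) ((t ^+ size u)%:C%C ^+ N.+1).
  by rewrite wE /cplx rmorphXn; exact: eigenvalueX.
have := le_spectral_radius (fun z => eig_le w z wS) eig_w.
rewrite normcX normc_real ger0_norm ?exprn_ge0 // -exprM mulnC -w_size => le_w.
have size_w : (size w)%:R != 0 :> R.
  by rewrite pnatr_eq0 w_size muln_eq0 -lt0n.
rewrite -[leLHS]powRr1 // -[X in t `^ X](mulfV size_w) powRrM powR_mulrn //.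
by apply: ge0_ler_powR; rewrite ?invr_ge0 ?ler0n ?nnegrE
  ?spectral_radius_ge0 ?exprn_ge0.
Qed.

(** * The polygon *)

Definition col2 {R : realType} (x y : R) : 'cV[R]_2 :=
  \col_i (if i == 0 then x else y).

Lemma mx22_col2 (R : realType) (a b c d x y : R) :
  mx22 a b c d *m col2 x y = col2 (a * x + b * y) (c * x + d * y).
Proof.
apply/matrixP => i j; rewrite !mxE !big_ord_recl big_ord0 !mxE /= addr0.
by case: ifP.
Qed.

Lemma col2D (R : realType) (x y x' y' : R) :
  col2 x y + col2 x' y' = col2 (x + x') (y + y').
Proof. by apply/matrixP => i j; rewrite !mxE; case: ifP. Qed.

Lemma col2Z (R : realType) (a x y : R) : a *: col2 x y = col2 (a * x) (a * y).
Proof. by apply/matrixP => i j; rewrite !mxE; case: ifP. Qed.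

Lemma mx22_tr (R : realType) (a b c d : R) : \tr (mx22 a b c d) = a + d.
Proof. by rewrite /mxtrace !big_ord_recl big_ord0 !mxE /= addr0. Qed.

Lemma mx22_det (R : realType) (a b c d : R) :
  \det (mx22 a b c d) = a * d - b * c.
Proof.
rewrite (expand_det_row _ 0) !big_ord_recl big_ord0 /cofactor !det_mx11 !mxE /=.
by rewrite /bump /=; ring.
Qed.

Lemma mx22M (R : realType) (a b c d a' b' c' d' : R) :
  mx22 a b c d * mx22 a' b' c' d' =
  mx22 (a * a' + b * c') (a * b' + b * d') (c * a' + d * c') (c * b' + d * d').
Proof.
apply/matrixP => i j; rewrite !mxE !big_ord_recl big_ord0 !mxE /= addr0.
by case: ifP => _; case: ifP.
Qed.

(** The list v0, v1, v2, w0, w1, w2 of the vertices of the polygon, up to sign: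
v_i = A^i v0 / t^i with v0 an eigenvector of B A A for k^2, and
w_i = B^i w0 / t^i with w0 an eigenvector of A B B for k^2. *)
Definition vertices {R : realType} (k t s : R) : seq 'cV[R]_2 :=
  [:: col2 (k ^+ 2 + 1) k; col2 (- t^-1) (k ^+ 3 / t);
      col2 (- (k ^+ 2 / t ^+ 2)) (- (k * (k ^+ 2 + 1) / t ^+ 2));
      col2 0 s; col2 (- (k * s / t)) (- (s / t)); col2 (k * s / t ^+ 2) 0].

Lemma pairing_col2 (R : realType) (v : 'rV[R[i]]_2) (x y : R) :
  pairing v (col2 x y) = v 0 0 * x%:C%C + v 0 1 * y%:C%C.
Proof.
rewrite /pairing mxE !big_ord_recl big_ord0 !mxE /= addr0.
by have -> : lift ord0 ord0 = 1 :> 'I_2 by apply/val_inj.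
Qed.

Lemma vertices_separating (R : realType) (k t s : R) (v : 'rV[R[i]]_2) :
  k != 0 -> t != 0 -> s != 0 ->
  (forall x, x \in vertices k t s -> pairing v x = 0) -> v = 0.
Proof.
move=> k0 t0 s0 v0; apply/rowP => j; rewrite mxE.
have v00 : v 0 0 = 0.
  have /eqP := v0 (col2 (k * s / t ^+ 2) 0) ltac:(by rewrite !inE eqxx !orbT).
  rewrite pairing_col2 rmorph0 mulr0 addr0 mulf_eq0 => /orP[/eqP//|].
  by rewrite fmorph_eq0 !mulf_eq0 invr_eq0 expf_eq0 (negbTE k0) (negbTE s0)
    (negbTE t0).
have v01 : v 0 1 = 0.
  have /eqP := v0 (col2 0 s) ltac:(by rewrite !inE eqxx !orbT).
  rewrite pairing_col2 rmorph0 mulr0 add0r mulf_eq0 => /orP[/eqP//|].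
  by rewrite fmorph_eq0 (negbTE s0).
have [->//|->//] : j = 0 \/ j = 1.
by case: j => [[|[|//]] lt_j]; [left|right]; apply/val_inj.
Qed.

Lemma in_hull2 (R : realType) d (V : seq 'cV[R]_d) (t a b : R) x y z :
  y \in V -> z \in V -> x = a *: y + b *: z -> `|a| + `|b| <= t ->
  in_hull t V x.
Proof. by move=> yV zV xE ab; exists y, z, a, b. Qed.

Lemma in_hull1 (R : realType) d (V : seq 'cV[R]_d) (t a : R) x y :
  y \in V -> x = a *: y -> `|a| <= t -> in_hull t V x.
Proof.
move=> yV -> at_; apply: (in_hull2 (a := a) (b := 0) yV yV).
  by rewrite scale0r addr0.
by rewrite normr0 addr0.
Qed.

(** Cancelling the common term t / k^4, which leaves the factor
(k^2 - 1) / k^4, reduces the two bounds on edges to t s <= k (k^2 + 1) and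
s k <= t (k^2 + 1).  Squared, with t^3 = k^2, these are s^2 <= t (k^2 + 1)^2,
true since s^2 <= (k^2 + 1)^2, and the hypothesis t s^2 <= (k^2 + 1)^2. *)
Lemma edge_bounds (R : realType) (k t s : R) :
  1 < k -> 1 < t -> 0 < s -> t ^+ 3 = k ^+ 2 ->
  s ^+ 2 = k ^+ 4 + k ^+ 2 + 1 -> t * s ^+ 2 <= (k ^+ 2 + 1) ^+ 2 ->
  [/\ `|t| <= t, `|t ^- 2| <= t,
      `|t / k ^+ 4| + `|t ^+ 2 * s * (k ^+ 2 - 1) / k ^+ 5| <= t &
      `|t / k ^+ 4| + `|s * (k ^+ 2 - 1) / k ^+ 3| <= t].
Proof.
move=> k1 t1 s0 t3 s2 ts2; have k0 : 0 < k by lra.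
have t0 : 0 < t by lra.
have k21 : 1 < k ^+ 2 by rewrite exprn_egt1.
have q0 : 0 <= (k ^+ 2 - 1) / k ^+ 4.
  by rewrite divr_ge0 ?exprn_ge0 ?subr_ge0 1?ltW.
have ts_le : t * s / k <= k ^+ 2 + 1.
  rewrite ler_pdivrMr // -ler_sqr ?nnegrE ?mulr_ge0 ?addr_ge0 ?sqr_ge0
    ?(ltW k0) ?(ltW t0) ?(ltW s0) //.
  have -> : ((k ^+ 2 + 1) * k) ^+ 2 = t ^+ 2 * (t * (k ^+ 2 + 1) ^+ 2).
    by ring: t3.
  rewrite exprMn ler_wpM2l ?sqr_ge0 // s2.
  apply: (@le_trans _ _ (1 * (k ^+ 2 + 1) ^+ 2)).
    by rewrite -subr_ge0 (_ : _ - _ = k ^+ 2) ?sqr_ge0 //; ring.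
  by rewrite ler_wpM2r ?sqr_ge0 // ltW.
have sk_le : s * k <= t * (k ^+ 2 + 1).
  rewrite -ler_sqr ?nnegrE ?mulr_ge0 ?addr_ge0 ?sqr_ge0
    ?(ltW k0) ?(ltW t0) ?(ltW s0) //.
  have -> : (s * k) ^+ 2 = t ^+ 2 * (t * s ^+ 2) by ring: t3.
  by rewrite exprMn ler_wpM2l ?sqr_ge0.
have tE : t = t / k ^+ 4 + t * ((k ^+ 2 - 1) / k ^+ 4 * (k ^+ 2 + 1)).
  by field; lra.
have norm_tk : `|t / k ^+ 4| = t / k ^+ 4.
  by rewrite ger0_norm // divr_ge0 ?exprn_ge0 ?(ltW t0) ?(ltW k0).
split; first by rewrite gtr0_norm.
- rewrite ger0_norm ?invr_ge0 ?sqr_ge0 //.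
  apply: (@le_trans _ _ 1); last exact: ltW.
  by rewrite invf_le1 ?exprn_gt0 // exprn_ege1 // ltW.
- have -> : t ^+ 2 * s * (k ^+ 2 - 1) / k ^+ 5 =
      t * ((k ^+ 2 - 1) / k ^+ 4 * (t * s / k)) by field; lra.
  rewrite norm_tk ger0_norm; last first.
    rewrite (mulr_ge0 (ltW t0)) // (mulr_ge0 q0) // divr_ge0 ?(ltW k0) //.
    by rewrite ltW ?mulr_gt0.
  rewrite [leRHS]tE lerD2l; apply: ler_wpM2l; first exact: ltW.
  exact: ler_wpM2l.
- have -> : s * (k ^+ 2 - 1) / k ^+ 3 = (k ^+ 2 - 1) / k ^+ 4 * (s * k).
    by field; lra.
  rewrite norm_tk ger0_norm; last by rewrite (mulr_ge0 q0) // ltW ?mulr_gt0.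
  by rewrite [leRHS]tE lerD2l [leRHS]mulrCA ler_wpM2l.
Qed.

(** The coefficients solve the linear systems A w0 = a w1 + b v2 and
A w1 = a w2 + b v1; the other four images are multiples of single vertices. *)
Lemma matA_vertices (R : realType) (k t s : R) :
  1 < k -> 1 < t -> 0 < s -> t ^+ 3 = k ^+ 2 ->
  s ^+ 2 = k ^+ 4 + k ^+ 2 + 1 -> t * s ^+ 2 <= (k ^+ 2 + 1) ^+ 2 ->
  forall x, x \in vertices k t s ->
    in_hull t (vertices k t s) (matA k *m x).
Proof.
move=> k1 t1 s0 t3 s2 ts2 x.
have [le_t le_tV edge1 edge2] := edge_bounds k1 t1 s0 t3 s2 ts2.
have [k0 [t0 s0']] : k != 0 /\ t != 0 /\ s != 0 by rewrite !gt_eqF //; lra.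
have nthV i : (i < 6)%N -> nth 0 (vertices k t s) i \in vertices k t s.
  by move=> i6; exact: mem_nth.
rewrite !inE => /or4P[/eqP->|/eqP->|/eqP->|/or3P[/eqP->|/eqP->|/eqP->]];
  rewrite /matA mx22_col2.
- apply: in_hull1 (nthV 1 isT) _ le_t; rewrite col2Z.
  by congr col2; field: t3; rewrite ?k0 ?t0.
- apply: in_hull1 (nthV 2 isT) _ le_t; rewrite col2Z.
  by congr col2; field: t3; rewrite ?k0 ?t0.
- apply: in_hull1 (nthV 0 isT) _ le_tV; rewrite col2Z.
  by congr col2; field: t3; rewrite ?k0 ?t0.
- apply: in_hull2 (nthV 4 isT) (nthV 2 isT) _ edge1.
  rewrite !col2Z col2D.
  by congr col2; field: t3 s2; rewrite ?k0 ?t0 ?s0'.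
- rewrite -(normrN (s * _ / _)) in edge2.
  apply: in_hull2 (nthV 5 isT) (nthV 1 isT) _ edge2.
  rewrite !col2Z col2D.
  by congr col2; field: t3 s2; rewrite ?k0 ?t0 ?s0'.
- apply: in_hull1 (nthV 3 isT) _ le_t; rewrite col2Z.
  by congr col2; field: t3; rewrite ?k0 ?t0.
Qed.

(** The half-turn that exchanges A with B and v_i with w_i turns the relations
of [matA_vertices] into these, up to signs of the coefficients. *)
Lemma matB_vertices (R : realType) (k t s : R) :
  1 < k -> 1 < t -> 0 < s -> t ^+ 3 = k ^+ 2 ->
  s ^+ 2 = k ^+ 4 + k ^+ 2 + 1 -> t * s ^+ 2 <= (k ^+ 2 + 1) ^+ 2 ->
  forall x, x \in vertices k t s ->
    in_hull t (vertices k t s) (matB k *m x).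
Proof.
move=> k1 t1 s0 t3 s2 ts2 x.
have [le_t le_tV edge1 edge2] := edge_bounds k1 t1 s0 t3 s2 ts2.
have [k0 [t0 s0']] : k != 0 /\ t != 0 /\ s != 0 by rewrite !gt_eqF //; lra.
have nthV i : (i < 6)%N -> nth 0 (vertices k t s) i \in vertices k t s.
  by move=> i6; exact: mem_nth.
rewrite !inE => /or4P[/eqP->|/eqP->|/eqP->|/or3P[/eqP->|/eqP->|/eqP->]];
  rewrite /matB mx22_col2.
- rewrite -(normrN (t ^+ 2 * s * _ / _)) in edge1.
  apply: in_hull2 (nthV 1 isT) (nthV 5 isT) _ edge1.
  rewrite !col2Z col2D.
  by congr col2; field: t3 s2; rewrite ?k0 ?t0 ?s0'.
- apply: in_hull2 (nthV 2 isT) (nthV 4 isT) _ edge2.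
  rewrite !col2Z col2D.
  by congr col2; field: t3 s2; rewrite ?k0 ?t0 ?s0'.
- apply: in_hull1 (nthV 0 isT) _ le_t; rewrite col2Z.
  by congr col2; field: t3; rewrite ?k0 ?t0.
- apply: in_hull1 (nthV 4 isT) _ le_t; rewrite col2Z.
  by congr col2; field: t3; rewrite ?k0 ?t0.
- apply: in_hull1 (nthV 5 isT) _ le_t; rewrite col2Z.
  by congr col2; field: t3; rewrite ?k0 ?t0.
- apply: in_hull1 (nthV 3 isT) _ le_tV; rewrite col2Z.
  by congr col2; field: t3; rewrite ?k0 ?t0.
Qed.

(** * The generalized spectral radius *)

(** The last inequality says kpoly t <= 0, and kpoly is increasing on [1, +oo[
with root kappa_max^(2/3). *)
Lemma kappa_threshold (R : realType) (k : R) :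
  1 < k -> k <= kappa_max R ->
  let t := k `^ (2 / 3) in
  [/\ 1 < t, t ^+ 3 = k ^+ 2 &
      t * (k ^+ 4 + k ^+ 2 + 1) <= (k ^+ 2 + 1) ^+ 2].
Proof.
move=> k1 kmax t; have k0 : 0 <= k by lra.
have t3 : t ^+ 3 = k ^+ 2.
  by rewrite -powR_mulrn ?powR_ge0 // -powRrM divfK ?pnatr_eq0 // powR_mulrn.
have t0 : 0 <= t by exact: powR_ge0.
have t1 : 1 < t.
  rewrite ltNge; apply/negP => t_le1.
  have : t ^+ 3 <= 1 by rewrite exprn_ile1.
  by rewrite t3 leNgt exprn_egt1.
split=> //; have [km1 _] := kappa_maxP R.
have /(kappa_max_eqE km1) km_root := kappa_maxP R.
have : kpoly t <= 0.
  have : t <= kappa_max R `^ (2 / 3).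
    by apply: ge0_ler_powR; rewrite ?nnegrE //; lra.
  rewrite le_eqVlt => /orP[/eqP->|lt_t]; first by rewrite km_root.
  by rewrite -km_root ltW // kpoly_inc // ltW.
rewrite -subr_ge0 => kp.
rewrite -subr_ge0.
have -> : (k ^+ 2 + 1) ^+ 2 - t * (k ^+ 4 + k ^+ 2 + 1) = 0 - kpoly t.
  by rewrite /kpoly; ring: t3.
by [].
Qed.

Theorem mainTheorem4 (R : realType) (k : R)
    (hk_gt1 : 1 < k) (hk_le : k <= kappa_max R) :
  let A := matA k in
  let B := matB k in
  let S := [fset A; B]%fset in
  let lambda := spectral_radius (B * A * A) in
  [/\ generalized_spectral_radius S = (lambda `^ (1 / 3))%:E,
      lambda = spectral_radius (B * B * A),
      lambda = k ^+ 2,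
      spectrum_maximizing S [:: B; A; A] &
      spectrum_maximizing S [:: B; B; A]].
Proof.
move=> A B S lambda.
have [t1 t3 t_le] := kappa_threshold hk_gt1 hk_le.
set t := k `^ (2 / 3) in t1 t3 t_le.
have k0 : k != 0 by lra.
pose s := Num.sqrt (k ^+ 4 + k ^+ 2 + 1).
have s_arg : 0 < k ^+ 4 + k ^+ 2 + 1.
  by rewrite addr_gt0 ?addr_gt0 ?exprn_gt0 //; lra.
have s_gt0 : 0 < s by rewrite sqrtr_gt0.
have s2 : s ^+ 2 = k ^+ 4 + k ^+ 2 + 1 by rewrite sqr_sqrtr // ltW.
have ts2 : t * s ^+ 2 <= (k ^+ 2 + 1) ^+ 2 by rewrite s2.
have S_hull X x : X \in S -> x \in vertices k t s ->
    in_hull t (vertices k t s) (X *m x).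
  move=> /fset2P[->|->]; first exact: matA_vertices.
  exact: matB_vertices.
have [t0 s0] : t != 0 /\ s != 0 by rewrite !gt_eqF //; lra.
have eig_le (w : seq 'M[R]_2) z : {subset w <= S} ->
    eigenvalue (cplx (word_prod w)) z -> Normc.normc z <= t ^+ size w.
  by apply: eigenvalue_word_le S_hull _ _ _ => v; exact: vertices_separating.
have detA : \det A = 1 by rewrite mx22_det; field.
have detB : \det B = 1 by rewrite mx22_det; field.
have k2_ge1 : 1 <= k ^+ 2 by rewrite exprn_ege1 // ltW.
have [eigBAA lambdaE] : eigenvalue (cplx (B * A * A)) (k ^+ 2)%:C%C /\
    lambda = k ^+ 2.
  apply: spectral_radius_det1 => //; last first.
    by rewrite !det_mulmx detA detB !mulr1.
  by rewrite !mx22M mx22_tr; field.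
have [_ BBA] : eigenvalue (cplx (B * B * A)) (k ^+ 2)%:C%C /\
    spectral_radius (B * B * A) = k ^+ 2.
  apply: spectral_radius_det1 => //; last first.
    by rewrite !det_mulmx detA detB !mulr1.
  by rewrite !mx22M mx22_tr; field.
have lambda_t : (k ^+ 2) `^ 3^-1 = t.
  rewrite -t3 -powR_mulrn ?powR_ge0 // -powRrM mulfV ?pnatr_eq0 //.
  by rewrite powRr1 ?powR_ge0.
have BAA_S : {subset [:: B; A; A] <= S}.
  by move=> X; rewrite !inE orbb orbC.
have BBA_S : {subset [:: B; B; A] <= S}.
  by move=> X; rewrite !inE orbA orbb orbC.
have prod_w X : word_prod [:: B; X; A] = B * X * A.
  by rewrite /word_prod !big_cons big_nil /= mulr1 mulrA.
have gsr : generalized_spectral_radius S = t%:E.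
  have eig_u : eigenvalue (cplx (word_prod [:: B; A; A]))
      (t ^+ size [:: B; A; A])%:C%C by rewrite prod_w /= t3.
  exact: (generalized_spectral_radius_max (ltW t1) eig_le _ BAA_S eig_u).
have third : 1 / 3 = 3^-1 :> R by rewrite mul1r.
split.
- by rewrite gsr third lambdaE lambda_t.
- by rewrite lambdaE BBA.
- exact: lambdaE.
- split; [by []|exact: BAA_S|].
  by rewrite gsr prod_w -/lambda lambdaE lambda_t.
- split; [by []|exact: BBA_S|].
  by rewrite gsr prod_w BBA lambda_t.
Qed.
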